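(* For each $n>1$ and each common type $\mathcal{T}_1$ of nondeterministic $\omega$-automata, there exists a $\mathcal{T}_1$ automaton $\mathcal{A}_n$ with $n$ states, over an alphabet whose size is bounded by a constant independent of $n$, such that: (i) for each common type $\mathcal{T}_2$, every $\mathcal{T}_2$ automaton that accepts the complement of $\mathcal{L}(\mathcal{A}_n)$ has at least $L(n)$ states; (ii) for each common type $\mathcal{T}_2$ other than Büchi and generalized Büchi, every deterministic $\mathcal{T}_2$ automaton that accepts $\mathcal{L}(\mathcal{A}_n)$ has at least $L(n)$ states.
   Context: An $\omega$-automaton is $(\Sigma,S,I,\Delta,Acc)$ with finite alphabet, finite states, $I\subseteq S$, $\Delta\subseteq S\times\Sigma\times S$. A run over $\alpha\in\Sigma^\omega$ is $\rho(0)\rho(1)\cdots$ with $\rho(0)\in I$ and $\langle\rho(i),\alpha(i),\rho(i+1)\rangle\in\Delta$; $Inf(\rho)$ is the set of states occurring infinitely often; $\alpha$ is accepted if some run is successful; the automaton is deterministic if $|I|=1$ and for each $p,a$ there is at most one $q$ with $\langle p,a,q\rangle\in\Delta$. The common types: Büchi ($Acc=F\subseteq S$, successful iff $Inf(\rho)\cap F\ne\emptyset$); generalized Büchi ($Acc=\{F_1,\dots,F_k\}$, iff $Inf(\rho)\cap F_i\ne\emptyset$ for all $i$); Rabin ($Acc=\{\langle G_i,B_i\rangle\}_{i\le k}$, iff for some $i$, $Inf(\rho)\cap G_i\ne\emptyset$ and $Inf(\rho)\cap B_i=\emptyset$); Streett (same form, iff for all $i$, $Inf(\rho)\cap B_i\ne\emptyset$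 implies $Inf(\rho)\cap G_i\ne\emptyset$); Muller ($Acc=\mathcal{F}\subseteq\mathcal{P}(S)$, iff $Inf(\rho)\in\mathcal{F}$); parity ($Acc=c:S\to\{0,\dots,l\}$, iff $\min\{c(q):q\in Inf(\rho)\}$ is even). For $n>1$ let $S'_n$ be a set of $n-1$ elements; for $1\le m<n$, a $Q(m)$-ranking is a function $h:S'_n\to\{0,\dots,2m-1\}$ attaining every odd value $1,3,\dots,2m-1$; $L(n,m)$ is their number and $L(n)=\max_{1\le m<n}L(n,m)$. *)

(* Defs.v *)
From mathcomp Require Import boolp classical_sets.
From mathcomp Require Import all_boot.

Set Implicit Arguments.
Unset Strict Implicit.
Unset Printing Implicit Defensive.

Inductive acc_type : Set :=
  Buchi | GenBuchi | Rabin | Streett | Muller | Parity.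

(* A Rabin or Streett pair is (G_i, B_i), in this order.
   A parity condition is a bound l with a colouring S -> {0, ..., l}. *)
Definition acc_cond (T : acc_type) (S : finType) : Type :=
  match T with
  | Buchi => {set S}
  | GenBuchi => seq {set S}
  | Rabin | Streett => seq ({set S} * {set S})
  | Muller => {set {set S}}
  | Parity => {l : nat & S -> 'I_l.+1}
  end.

Record automaton (T : acc_type) (Sigma : finType) := Automaton {
  state : finType;
  init : {set state};
  trans : {set state * Sigma * state};
  acc : acc_cond T state
}.

Definition Inf (S : finType) (rho : nat -> S) : {set S} :=
  [set q | `[< forall i, exists2 j, i <= j & rho j = q >]].

(* In the parity case the neutral element l of the minimum is harmless:
   colours are at most l and Inf rho is nonempty. *)
Definition successful (T : acc_type) (S : finType) :
    acc_cond T S -> (nat -> S) -> Prop :=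
  match T return acc_cond T S -> (nat -> S) -> Prop with
  | Buchi => fun F rho => Inf rho :&: F != set0
  | GenBuchi => fun Fs rho => forall F, F \in Fs -> Inf rho :&: F != set0
  | Rabin => fun ps rho => exists2 p, p \in ps &
      Inf rho :&: p.1 != set0 /\ Inf rho :&: p.2 = set0
  | Streett => fun ps rho => forall p, p \in ps ->
      Inf rho :&: p.2 != set0 -> Inf rho :&: p.1 != set0
  | Muller => fun F rho => Inf rho \in F
  | Parity => fun c rho =>
      ~~ odd (\big[minn/tag c]_(q in Inf rho) (tagged c q : nat))
  end.

Section Language.

Variables (T : acc_type) (Sigma : finType) (A : automaton T Sigma).

Definition run (alpha : nat -> Sigma) (rho : nat -> state A) : Prop :=
  rho 0 \in init A /\ forall i, (rho i, alpha i, rho i.+1) \in trans A.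

Definition lang : set (nat -> Sigma) :=
  [set alpha | exists2 rho, run alpha rho & successful (acc A) rho]%classic.

Definition deterministic : Prop :=
  #|init A| = 1 /\
  forall p a q q', (p, a, q) \in trans A -> (p, a, q') \in trans A -> q = q'.

End Language.

(* The set S'_n of n - 1 elements is taken to be 'I_n.-1. *)
Definition Q_ranking (n m : nat) (h : {ffun 'I_n.-1 -> 'I_(2 * m)}) : bool :=
  [forall i : 'I_m, exists x, h x == 2 * i + 1 :> nat].

Definition num_Q_rankings (n m : nat) : nat := #|@Q_ranking n m|.

Definition L (n : nat) : nat := \max_(1 <= m < n) num_Q_rankings n m.

(* Main.v *)
(* All types T1 share one transition structure on n - 1 "places" and a single
   accepting state: six letters suffice to permute the places, to add an edge
   between two of them (possibly through the accepting state) and to erase one.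
   For any two Q(m)-rankings f and g there is a word along which ranks decrease
   from f to g, strictly on a visit to the accepting state, and which connects p
   to q through the accepting state whenever f p > g q.  Concatenating such
   words along a sequence that repeats every Q(m)-ranking infinitely often gives
   a word alpha with no accepting path, since ranks cannot decrease forever.

   A run on alpha of an automaton with fewer states than there are rankings is
   in the same state infinitely often at f and infinitely often at g, for some
   f <> g.  If f p > g p, repeating a long factor of alpha leading from f to g
   keeps a run with the same infinity set, but the repeated word has an accepting
   path through p.  As only the infinity set of the run matters, this refutes
   every acceptance type at once, both for nondeterministic complements and for
   deterministic equivalents. *)
From HB Require Import structures.
Require Import Defs.
From mathcomp Require Import boolp classical_sets.
From mathcomp Require Import all_boot.
From mathcomp Require Import fingroup perm ssralg zmodp zify.

Set Implicit Arguments.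
Unset Strict Implicit.
Unset Printing Implicit Defensive.

(** * The alphabet of six letters *)

Inductive letter := Rotate | Swap | Edge | Enter | Exit | Kill.

Definition letter_code (a : letter) : 'I_6 :=
  match a with
  | Rotate => @Ordinal 6 0 isT | Swap => @Ordinal 6 1 isT
  | Edge => @Ordinal 6 2 isT | Enter => @Ordinal 6 3 isT
  | Exit => @Ordinal 6 4 isT | Kill => @Ordinal 6 5 isT
  end.

Definition letter_decode (i : 'I_6) : letter :=
  nth Kill [:: Rotate; Swap; Edge; Enter; Exit] i.

Lemma letter_codeK : cancel letter_code letter_decode.
Proof. by case. Qed.

HB.instance Definition _ := Finite.copy letter (can_type letter_codeK).

Lemma card_letter : #|{: letter}| <= 6.
Proof. by rewrite -[6]card_ord (leq_card letter_code (can_inj letter_codeK)). Qed.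

(** * Uniform bounds over finite sets, and generators of the symmetric group *)

Lemma uniform_bound (X : finType) (P : X -> nat -> Prop) :
  (forall x, exists b, forall i, b <= i -> P x i) ->
  exists b, forall x i, b <= i -> P x i.
Proof.
move=> /choice[b bP]; exists (\max_x b x) => x i le_bi.
by apply: bP; apply: leq_trans le_bi; apply: leq_bigmax.
Qed.

Lemma perm_extend (T : finType) (s1 s2 : seq T) :
  uniq s1 -> uniq s2 -> size s1 = size s2 ->
  exists sigma : {perm T}, map sigma s1 = s2.
Proof.
elim: s1 s2 => [|x s1 IH] [|y s2] //=; first by exists 1%g.
case/andP=> xs1 us1 /andP[ys2 us2] [sz].
have [pi pi_s1] := IH s2 us1 us2 sz.
exists (pi * tperm (pi x) y)%g.
rewrite permM tpermL; congr (_ :: _); rewrite -[RHS]pi_s1; apply/eq_in_map => z zs1.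
rewrite permM tpermD //.
  by apply: contraNneq xs1 => /perm_inj->.
by apply: contraNneq ys2 => ->; rewrite -pi_s1 map_f.
Qed.

(** [ordS] is addition of 1 modulo the number of points, and the two transposed points lie at
    distance 1, which is coprime to the length of the cycle. *)
Lemma gen_tperm_ordS n : 0 < n ->
  <<[set tperm ord0 (inord 1); perm (@ordS_inj n.+1)]>>%g = [set: {perm 'I_n.+1}].
Proof.
case: n => // n _.
have -> : perm (@ordS_inj n.+2) = perm (@GRing.addrI 'I_n.+2 1%R).
  by apply/permP => x; rewrite !permE; apply/val_inj.
rewrite gen_tpermn_circular_shift //.
by rewrite [(_ - _)%R](GRing.subr0 (inord 1)) inordK // coprimen1.
Qed.

(** * Paths along finite words, and ranks that bound them *)

Section Words.

Variable k : nat.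
Local Notation place := 'I_k.+1.
Local Notation node := (option 'I_k.+1).
Implicit Types (f g h : place -> nat) (w : seq letter) (p q : node).

(* [None] is the single accepting state; it has no outgoing transition except on
   [Exit], so a path survives it only on the factor [Enter; Exit]. *)
Definition step (a : letter) p q : bool :=
  match a, p with
  | Rotate, Some x => q == Some (ordS x)
  | Swap, Some x => q == Some (tperm ord0 (inord 1) x)
  | Edge, Some x => (q == Some x) || (x == ord0) && (q == Some (inord 1))
  | Enter, Some x => (q == Some x) || (x == ord0) && (q == None)
  | Exit, Some x => q == Some x
  | Exit, None => q == Some (inord 1)
  | Kill, Some x => (x != ord0) && (q == Some x)
  | _, None => false
  end.

(* [conn w true p q]: some path from [p] to [q] on [w] is in [None] before its
   last state. *)
Fixpoint conn w (v : bool) p q : bool :=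
  if w is a :: w' then
    [exists p', step a p p' && conn w' (v && (p != None)) p' q]
  else ~~ v && (p == q).

(** The flag is a demand, not a description: [false] also admits paths that visit [None]. *)
Lemma conn_weak {w} {u v : bool} {p q} : (u -> v) -> conn w v p q -> conn w u p q.
Proof.
elim: w u v p => [|a w IH] u v p uv /=.
  by case: u uv => [->|] //; case: v.
case/existsP=> p' /andP[pp' c]; apply/existsP; exists p'; rewrite pp' /=.
by apply: IH c => /andP[/uv-> ->].
Qed.

Lemma conn_cat {w1 w2 u v p q r} :
  conn w1 u p q -> conn w2 v q r -> conn (w1 ++ w2) (u || v) p r.
Proof.
elim: w1 u p => [|a w1 IH] u p /=.
  by case/andP => /negbTE-> /eqP->.
case/existsP=> p' /andP[pp' c] c2; apply/existsP; exists p'; rewrite pp' /=.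
by apply: conn_weak (IH _ _ c c2); case: (u) (v) (p != None) => [] [] [].
Qed.

Lemma conn_catl {w1 w2 v p q r} :
  conn w1 v p q -> conn w2 false q r -> conn (w1 ++ w2) v p r.
Proof. by rewrite -{2}[v]orbF; exact: conn_cat. Qed.

Lemma conn_catr {w1 w2 v p q r} :
  conn w1 false p q -> conn w2 v q r -> conn (w1 ++ w2) v p r.
Proof. exact: conn_cat. Qed.

Lemma conn_cat_inv {w1 w2 v p r} : conn (w1 ++ w2) v p r ->
  exists q v1 v2, [/\ conn w1 v1 p q, conn w2 v2 q r & v -> v1 || v2].
Proof.
elim: w1 v p => [|a w1 IH] v p /=.
  by move=> c; exists p, false, v; rewrite eqxx.
case/existsP=> p' /andP[pp' /IH[q [v1 [v2 [c1 c2 vv]]]]].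
exists q, (v1 || (p == None)), v2; split=> //.
  apply/existsP; exists p'; rewrite pp'; apply: conn_weak c1.
  by case: v1 vv => //= _; case: eqP.
by move=> v_; move: vv; rewrite v_ /=; case: (p == None) => /=;
  rewrite ?orbT //; rewrite orbF; apply.
Qed.

Lemma conn1 a v x q : conn [:: a] v (Some x) q = ~~ v && step a (Some x) q.
Proof.
rewrite /= andbT; apply/existsP/andP => [[p' /and3P[? ? /eqP<-]]|[]] //.
by exists q; rewrite eqxx andbT; apply/andP.
Qed.

(** Each visit to [None] has to be paid for by a drop in rank, the coercion of [v] to 0 or 1 being
    the price. No path from a place may end in [None]. *)
Definition sound w f g :=
  forall x q (v : bool), conn w v (Some x) q ->
  exists2 y, q = Some y & g y + v <= f x.

Lemma sound_nil f g : (forall x, g x <= f x) -> sound [::] f g.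
Proof.
by move=> le_gf x q v /andP[/negbTE-> /eqP<-]; exists x; rewrite ?addn0.
Qed.

Lemma sound_cat w1 w2 f g h :
  sound w1 f g -> sound w2 g h -> sound (w1 ++ w2) f h.
Proof.
move=> s1 s2 x r v /conn_cat_inv[q [v1 [v2 [/s1[y -> le1] /s2[z -> le2] vv]]]].
exists z => //; case: v vv => [/(_ isT)|_]; case: v1 v2 le1 le2 => [] [] //=; lia.
Qed.

(** The permutations realised by words contain [Swap] and [Rotate] and are closed under product, and
    these two generate the symmetric group. *)
Lemma perm_word (sigma : {perm place}) :
  exists w, forall v x q, conn w v (Some x) q = ~~ v && (q == Some (sigma x)).
Proof.
pose P (s : {perm place}) := exists w, forall v x q,
  conn w v (Some x) q = ~~ v && (q == Some (s x)).
have P1 : P 1%g by exists [::] => v x q; rewrite /= perm1 eq_sym.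
have PM s t : P s -> P t -> P (s * t)%g.
  move=> [w1 h1] [w2 h2]; exists (w1 ++ w2) => v x q.
  apply/idP/andP => [/conn_cat_inv[r [v1 [v2 []]]]|[/negbTE-> /eqP->]].
    rewrite h1 => /andP[/negbTE-> /eqP->]; rewrite h2 permM.
    by case/andP=> /negbTE-> ->; case: v => // /(_ isT).
  by apply: (@conn_catr _ _ false _ (Some (s x)));
    rewrite ?h1 ?h2 ?permM /= eqxx.
have PX s : s \in [set tperm ord0 (inord 1); perm (@ordS_inj k.+1)] -> P s.
  by rewrite !inE => /orP[] /eqP->; [exists [:: Swap]|exists [:: Rotate]];
    move=> v x q; rewrite conn1 /= ?permE.
rewrite -/(P sigma).
have [k0|k_gt0] := posnP k.
  suff -> : sigma = 1%g by [].
  apply/permP => x; rewrite perm1; apply/val_inj => /=.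
  by have := ltn_ord (sigma x); have := ltn_ord x; lia.
have : sigma \in <<[set tperm ord0 (inord 1); perm (@ordS_inj k.+1)]>>%g.
  by rewrite gen_tperm_ordS ?inE.
by case/gen_prodgP=> n [c cX ->]; elim/big_ind: _ => // i _; apply/PX/cX.
Qed.

Lemma sound_perm w (sigma : {perm place}) f g :
  (forall v x q, conn w v (Some x) q = ~~ v && (q == Some (sigma x))) ->
  (forall x, g (sigma x) <= f x) -> sound w f g.
Proof.
move=> ws le_gf x q v; rewrite ws => /andP[/negbTE-> /eqP->].
by exists (sigma x); rewrite ?addn0.
Qed.

(** Between equal ranks a detour through [None] would be unsound, so plain [Edge] is used; a strict
    drop pays for the detour [Enter], [Exit]. *)
Lemma edge_letters f : f (inord 1) <= f ord0 ->
  exists w, [/\ sound w f f, forall x, conn w false (Some x) (Some x)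
    & conn w (f (inord 1) < f ord0) (Some ord0) (Some (inord 1))].
Proof.
rewrite leq_eqVlt => /orP[/eqP e|lt10].
  exists [:: Edge]; split.
  - move=> x q v; rewrite conn1 /= => /andP[/negbTE->].
    case/orP=> [/eqP->|/andP[/eqP-> /eqP->]]; first by exists x; rewrite ?addn0.
    by exists (inord 1); rewrite ?e ?addn0.
  - by move=> x; rewrite conn1 /= eqxx.
  - by rewrite conn1 e ltnn /= !eqxx orbT.
exists [:: Enter; Exit]; split.
- move=> x q v /=; case/existsP=> p' /andP[/orP[/eqP->|/andP[/eqP-> /eqP->]]].
    case/existsP=> p'' /and3P[/eqP-> v0 /eqP<-]; exists x => //.
    by move: v0; case: v; rewrite /= ?addn0.
  case/existsP=> p'' /and3P[/eqP-> v0 /eqP<-]; exists (inord 1) => //.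
  by case: v {v0} => /=; lia.
- by move=> x /=; apply/existsP; exists (Some x); rewrite eqxx /=;
    apply/existsP; exists (Some x); rewrite eqxx.
- rewrite lt10 /=; apply/existsP; exists None; rewrite eqxx orbT /=.
  by apply/existsP; exists (Some (inord 1)); rewrite !eqxx.
Qed.

Lemma edge_word f (x y : place) : f y <= f x ->
  exists w, [/\ sound w f f, forall z, conn w false (Some z) (Some z)
    & conn w (f y < f x) (Some x) (Some y)].
Proof.
have [<- _|nxy le_yx] := eqVneq x y.
  by exists [::]; split=> //=; [apply: sound_nil|rewrite ltnn eqxx].
have n01 : (inord 1 : place) != ord0.
  move: k x y nxy {le_yx f} => [|n] x y; first by rewrite !ord1 eqxx.
  by move=> _; rewrite -val_eqE /= inordK.
pose a := tperm ord0 x (inord 1).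
(* The first factor sends [ord0] to [x]; the second then corrects the image [a] of [inord 1] to [y]
   while fixing [x]. Conjugation by [sigma] moves the edge from [ord0], [inord 1] to [x], [y]. *)
pose sigma := (tperm ord0 x * tperm a y)%g.
have nax : a != x by rewrite -[X in _ != X](tpermL ord0 x) (inj_eq perm_inj).
have s0 : sigma ord0 = x by rewrite permM tpermL tpermD // eq_sym.
have s1 : sigma (inord 1) = y by rewrite permM tpermL.
have [w1 h1] := perm_word sigma^-1; have [w2 h2] := perm_word sigma.
have [] := @edge_letters (f \o sigma); rewrite /= s0 s1 // => w [sw wid w01].
exists (w1 ++ w ++ w2); split.
- apply: (@sound_cat _ _ _ (f \o sigma)).
    by apply: sound_perm h1 _ => z /=; rewrite permKV.
  by apply: sound_cat sw _; apply: sound_perm h2 _.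
- move=> z; apply: (@conn_catr _ _ false _ (Some (sigma^-1%g z))).
    by rewrite h1 /=.
  apply: (conn_catr (wid _)).
  by rewrite h2 permKV /=.
- apply: (@conn_catr _ _ _ _ (Some ord0)).
    by rewrite h1 -s0 permK /=.
  by apply: conn_catl w01 _; rewrite h2 s1 /=.
Qed.

(** Edge words for all pairs are concatenated; since each lets every place stay where it is, no
    connection gained is lost again. *)
Lemma saturation_word f : exists w, [/\ 0 < size w, sound w f f &
  forall x y, f y <= f x -> conn w (f y < f x) (Some x) (Some y)].
Proof.
suff /(_ (enum {: place * place}))[w [w_gt0 sw _ wl]] :
    forall l : seq (place * place), exists w,
    [/\ 0 < size w, sound w f f, forall z, conn w false (Some z) (Some z)
      & forall x y, (x, y) \in l -> f y <= f x ->
        conn w (f y < f x) (Some x) (Some y)].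
  by exists w; split=> // x y; apply: wl; rewrite mem_enum.
elim=> [|[x y] l [w [w_gt0 sw wid wl]]].
  (* [Exit] fixes every place and serves only to make the word nonempty. *)
  exists [:: Exit]; split=> // [x q v|z]; last by rewrite conn1 /= eqxx.
  by rewrite conn1 => /andP[/negbTE-> /eqP->]; exists x; rewrite ?addn0.
have [w' [sw' wid' w'xy]] : exists w, [/\ sound w f f,
    forall z, conn w false (Some z) (Some z)
    & f y <= f x -> conn w (f y < f x) (Some x) (Some y)].
  have [/edge_word[w' [? ? ?]]|lt_xy] := leqP (f y) (f x); first by exists w'.
  by exists [::]; split=> //=; apply: sound_nil.
exists (w' ++ w); split.
- by rewrite size_cat addn_gt0 w_gt0 orbT.
- exact: sound_cat sw' sw.
- by move=> z; apply: conn_cat (wid' z) (wid z).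
move=> x' y' /predU1P[[-> ->]|l_xy] le_yx.
  by apply: conn_catl (w'xy le_yx) (wid _).
exact: conn_catr (wid' _) (wl _ _ l_xy le_yx).
Qed.

Lemma kill_word (l : seq place) : exists w,
  (forall x, x \notin l -> conn w false (Some x) (Some x)) /\
  forall f g, (forall x, x \notin l -> g x <= f x) -> sound w f g.
Proof.
elim: l => [|z l [w [wid sw]]].
  exists [::]; split=> [x _|f g le_gf] /=; first by rewrite eqxx.
  by apply: sound_nil => x; apply: le_gf.
have [w1 h1] := perm_word (tperm ord0 z).
exists (w1 ++ [:: Kill] ++ w1 ++ w); split=> [x|f g le_gf].
  rewrite inE => /norP[nxz xl].
  apply: (@conn_catr _ _ false _ (Some (tperm ord0 z x))).
    by rewrite h1 /=.
  apply: (@conn_catr _ _ false _ (Some (tperm ord0 z x))).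
    rewrite conn1 /= eqxx andbT -[X in _ != X](tpermR ord0 z) (inj_eq perm_inj).
    by rewrite nxz.
  apply: (@conn_catr _ _ false _ (Some x)); last exact: wid.
  by rewrite h1 tpermK /=.
(* Once [z] is erased no path is there, so its rank may be reset to [g z], as the induction
   hypothesis for [l] requires. *)
pose f' x := if x == z then g x else f x.
apply: (@sound_cat _ _ _ (f \o tperm ord0 z)).
  by apply: sound_perm h1 _ => x /=; rewrite tpermK.
apply: (@sound_cat _ _ _ (f' \o tperm ord0 z)).
  move=> x q v; rewrite conn1 => /and3P[/negbTE-> nx /eqP->]; exists x => //.
  rewrite addn0 /= /f' ifN // -[X in _ != X](tpermL ord0 z) (inj_eq perm_inj) //.
apply: (@sound_cat _ _ _ f').
  by apply: sound_perm h1 _ => x /=.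
by apply: sw => x xl; rewrite /f'; case: eqP => // /eqP nxz;
  apply: le_gf; rewrite inE negb_or nxz.
Qed.

(** * Words that link two rankings *)

Definition odd_onto m f := forall i, i < m -> exists x, f x = 2 * i + 1.

(* A strict descent between [f] and [g] always has an odd value in between, and
   descending through places of odd rank is what makes links compose. *)
Definition link m w f g := sound w f g /\
  forall x y i, i < m -> g y <= 2 * i + 1 <= f x ->
    conn w (g y < f x) (Some x) (Some y).

(** The two paths meet at a place of rank [2 * i + 1] under [g]; if [h z < f x], at least one half
    is strict and supplies the visit to [None]. *)
Lemma link_cat m w1 w2 f g h : odd_onto m g ->
  link m w1 f g -> link m w2 g h -> link m (w1 ++ w2) f h.
Proof.
move=> g_onto [s1 c1] [s2 c2]; split; first exact: sound_cat s1 s2.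
move=> x z i lt_im /andP[le_z le_x]; have [y gy] := g_onto i lt_im.
have := conn_cat (c1 x y i lt_im _) (c2 y z i lt_im _); rewrite gy leqnn le_z le_x.
by move=> /(_ isT isT); apply: conn_weak; lia.
Qed.

Lemma odd_onto_places m f : odd_onto m f ->
  exists a : 'I_m -> place, injective a /\ forall i, f (a i) = 2 * i + 1.
Proof.
move=> f_onto.
have [a fa] : exists a : 'I_m -> place, forall i, f (a i) = 2 * i + 1.
  have /choice[a fa] : forall i : 'I_m, exists x, f x = 2 * i + 1.
    by move=> i; apply: f_onto.
  by exists a.
exists a; split=> // i j eq_a; apply: val_inj => /=.
by have := fa j; rewrite -eq_a fa; lia.
Qed.

(** Saturation under [f] leads from [x] down to a chosen place of odd rank, a permutation carries it
    to the place of the same odd rank under [g], and saturation under [g] leads on to [y]. The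
    places not chosen for [g] are erased in between, because there the rank might increase. *)
Lemma link_word m f g : odd_onto m f -> odd_onto m g ->
  exists w, 0 < size w /\ link m w f g.
Proof.
case/odd_onto_places=> a [a_inj fa] /odd_onto_places[b [b_inj gb]].
have [|||sigma sigma_ab] := @perm_extend _ (map a (enum 'I_m)) (map b (enum 'I_m)).
- by rewrite map_inj_uniq ?enum_uniq.
- by rewrite map_inj_uniq ?enum_uniq.
- by rewrite !size_map.
have {}sigma_ab i : sigma (a i) = b i.
  move: sigma_ab; rewrite -map_comp => /eq_in_map; apply.
  by rewrite mem_enum.
have [wf [wf_gt0 swf cwf]] := saturation_word f.
have [wp cwp] := perm_word sigma.
have [wk [cwk swk]] := kill_word [seq x <- enum place | x \notin codom b].
have [wg [_ swg cwg]] := saturation_word g.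
have memk x : (x \notin [seq x <- enum place | x \notin codom b]) = (x \in codom b).
  by rewrite mem_filter mem_enum andbT negbK.
exists (wf ++ wp ++ wk ++ wg); split; first by rewrite size_cat addn_gt0 wf_gt0.
split.
  apply: sound_cat swf _; apply: (@sound_cat _ _ _ (f \o sigma^-1%g)).
    by apply: sound_perm cwp _ => x /=; rewrite permK.
  apply: sound_cat swg; apply: swk => x; rewrite memk => /codomP[i ->] /=.
  by rewrite -sigma_ab permK fa sigma_ab gb.
move=> x y i lt_im /andP[le_y le_x]; pose o := Ordinal lt_im.
have c1 : conn wf (2 * i + 1 < f x) (Some x) (Some (a o)).
  by have := cwf x (a o); rewrite fa /=; apply.
have c2 : conn (wp ++ wk) false (Some (a o)) (Some (b o)).
  apply: (@conn_catr _ _ _ _ (Some (b o))); first by rewrite cwp sigma_ab /=.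
  by apply: cwk; rewrite memk codom_f.
have c3 : conn wg (g y < 2 * i + 1) (Some (b o)) (Some y).
  by have := cwg (b o) y; rewrite gb /=; apply.
have := conn_cat c1 (conn_catr c2 c3); rewrite -!catA; apply: conn_weak; lia.
Qed.

End Words.

(** * Factors of infinite words, and their periodic repetition *)

Section Factors.

Variable T : Type.
Implicit Types (alpha : nat -> T) (V : nat -> seq T).

Definition factor alpha s t := [seq alpha i | i <- iota s (t - s)].

Lemma factor_cat alpha r s t : r <= s <= t ->
  factor alpha r t = factor alpha r s ++ factor alpha s t.
Proof.
case/andP=> le_rs le_st; rewrite /factor -map_cat; congr map.
have -> : t - r = (s - r) + (t - s) by lia.
by rewrite iotaD subnKC.
Qed.

Lemma factorS alpha s t : s < t ->
  factor alpha s t = alpha s :: factor alpha s.+1 t.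
Proof. by rewrite /factor => lt_st; rewrite -(subnSK lt_st). Qed.

Lemma concat_words V : (forall j, 0 < size (V j)) ->
  exists alpha (t : nat -> nat), t 0 = 0 /\
    forall j, t j < t j.+1 /\ factor alpha (t j) (t j.+1) = V j.
Proof.
move=> V_gt0; have x0 : T by case: (V 0) (V_gt0 0).
pose W n := flatten [seq V j | j <- iota 0 n].
have WS n : W n.+1 = W n ++ V n.
  by rewrite /W -addn1 iotaD map_cat flatten_cat /= cats0.
have W_size n : n <= size (W n).
  by elim: n => // n IH; rewrite WS size_cat; have := V_gt0 n; lia.
have W_nth n i : i < size (W n) -> nth x0 (W n) i = nth x0 (W i.+1) i.
  have aux d m : i < size (W m) -> nth x0 (W (m + d)) i = nth x0 (W m) i.
    move=> lt_i; elim: d => [|d IH]; first by rewrite addn0.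
    rewrite addnS WS nth_cat IH ifT //.
    apply: leq_trans lt_i _; elim: d {IH} => [|d IH]; first by rewrite addn0.
    by rewrite addnS WS size_cat (leq_trans IH) ?leq_addr.
  move=> lt_i; have [le|lt] := leqP n i.+1.
    by rewrite -(subnKC le) aux.
  by rewrite -(subnKC (ltnW lt)) aux.
(* The words are nonempty, so the prefix [W i.+1] is long enough to contain position [i]. *)
exists (fun i => nth x0 (W i.+1) i), (fun n => size (W n)); split=> // j.
have sWS : size (W j.+1) = size (W j) + size (V j) by rewrite WS size_cat.
split; first by rewrite sWS -addn1 leq_add2l.
apply: (@eq_from_nth _ x0); rewrite size_map size_iota sWS addKn // => i lt_i.
rewrite (nth_map 0) addKn ?size_iota // nth_iota //.
by rewrite -(W_nth j.+1) ?sWS ?ltn_add2l // WS nth_cat ltnNge leq_addr /= addKn.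
Qed.

(** Composing with [wrap s t] turns $\alpha$ into the ultimately periodic word $uv^\omega$, where
    $u$ is the prefix of length $s$ and $v$ the factor from $s$ to $t$. *)
Definition wrap s t i := if i < s then i else s + (i - s) %% (t - s).

Lemma ltn_wrap s t i : s < t -> wrap s t i < t.
Proof. by rewrite /wrap => lt_st; case: ifP; have := @ltn_pmod (i - s) (t - s); lia. Qed.

Lemma wrap_id s t i : i < t -> wrap s t i = i.
Proof. by rewrite /wrap => lt_it; case: ifP => // le_si; rewrite modn_small; lia. Qed.

Lemma wrap_addM s t i n : s <= i < t -> wrap s t (i + n * (t - s)) = i.
Proof.
case/andP=> le_si lt_it; rewrite /wrap ltnNge (leq_trans le_si) ?leq_addr //=.
by rewrite -addnBAC // [_ + n * _]addnC modnMDl modn_small; lia.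
Qed.

Lemma wrapS s t i : s < t ->
  wrap s t i.+1 = if (wrap s t i).+1 == t then s else (wrap s t i).+1.
Proof.
move=> lt_st; rewrite /wrap.
have [lt_is|le_si] := ltnP i s.
  have -> : (i.+1 == t) = false by lia.
  case: ltnP => // le_si; have -> : i.+1 = s by lia.
  by rewrite subnn mod0n addn0.
rewrite ltnNge leqW //= subSn //.
have : (i - s) %% (t - s) < t - s by rewrite ltn_pmod ?subn_gt0.
rewrite {2}(divn_eq (i - s) (t - s)) -addnS modnMDl.
set r := (i - s) %% (t - s) => lt_r.
case: eqP => [e|ne]; last by rewrite modn_small; lia.
have -> : r.+1 = t - s by lia.
by rewrite modnn addn0.
Qed.

(** The only jump is from [t] back to [s], where [rho] takes equal values. The relation [E] covers
    both runs of an arbitrary automaton and paths of nodes. *)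
Lemma wrap_path (X : Type) (E : nat -> X -> X -> Prop) (rho : nat -> X) s t :
  s < t -> rho s = rho t -> (forall i, i < t -> E i (rho i) (rho i.+1)) ->
  forall i, E (wrap s t i) (rho (wrap s t i)) (rho (wrap s t i.+1)).
Proof.
move=> lt_st eq_rho rhoE i; have := rhoE _ (ltn_wrap i lt_st).
by rewrite (wrapS _ lt_st); case: eqP => [->|//]; rewrite eq_rho.
Qed.

End Factors.

(** * Infinity sets and recurrence *)

Lemma InfP (X : finType) (rho : nat -> X) q :
  q \in Inf rho <-> forall i, exists2 j, i <= j & rho j = q.
Proof. by rewrite inE; split=> /asboolP. Qed.

(** The loop starts after all transient states have disappeared and is long enough to show every
    recurring one. *)
Lemma Inf_wrap (X : finType) (rho : nat -> X) s t : s < t ->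
  (forall i, s <= i -> rho i \in Inf rho) ->
  (forall q, q \in Inf rho -> exists2 i, s <= i < t & rho i = q) ->
  Inf (rho \o wrap s t) = Inf rho.
Proof.
move=> lt_st rho_Inf Inf_rho; apply/setP => q; apply/idP/idP.
  move=> /InfP/(_ s)[i le_si <-] /=; apply: rho_Inf.
  by rewrite /wrap ltnNge le_si leq_addr.
case/Inf_rho=> i lt_i <-; apply/InfP => n; exists (i + n * (t - s)) => /=.
  by rewrite -[X in X <= _]muln1; have := leq_mul2l n 1 (t - s); lia.
by rewrite wrap_addM.
Qed.

Lemma eventually_Inf (X : finType) (rho : nat -> X) :
  exists b, forall i, b <= i -> rho i \in Inf rho.
Proof.
have [q|b bP] := @uniform_bound X (fun q i => rho i = q -> q \in Inf rho).
  have [|/negP qI] := boolP (q \in Inf rho); first by exists 0.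
  apply: contrapT => no; apply/qI/InfP => i.
  apply: contrapT => no'; apply: no; exists i => j le_ij rj.
  by case: no'; exists j.
by exists b => i /bP; apply.
Qed.

Lemma Inf_cover (X : finType) (rho : nat -> X) s :
  exists b, forall t, b <= t -> forall q, q \in Inf rho ->
    exists2 i, s <= i < t & rho i = q.
Proof.
have [q|b bP] := @uniform_bound X
  (fun q t => q \in Inf rho -> exists2 i, s <= i < t & rho i = q).
  have [/InfP/(_ s)[i le_si ri]|_] := boolP (q \in Inf rho); last by exists 0.
  by exists i.+1 => t lt_it _; exists i; rewrite ?le_si.
by exists b => t le_bt q; apply: bP.
Qed.

Lemma infinite_pigeonhole (X : finType) (u : nat -> X) (P : nat -> Prop) :
  (forall i, exists2 j, i <= j & P j) ->
  exists q, forall i, exists2 j, i <= j & P j /\ u j = q.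
Proof.
move=> infP; apply: contrapT => no.
have [q|b bP] := @uniform_bound X (fun q j => P j -> u j <> q).
  apply: contrapT => no'; apply: no; exists q => i.
  apply: contrapT => no''; apply: no'; exists i => j le_ij Pj uj.
  by case: no''; exists j.
by have [j le_bj Pj] := infP b; apply: (bP (u j) j).
Qed.

Lemma cyclic_enumeration (X : finType) (A : pred X) : 0 < #|A| ->
  exists h : nat -> X, (forall j, h j \in A) /\
    forall x, x \in A -> forall i, exists2 j, i <= j & h j = x.
Proof.
move=> A_gt0; have [x0 Ax0] := card_gt0P A_gt0.
exists (fun j => nth x0 (enum A) (j %% #|A|)); split=> [j|x Ax i].
  by rewrite -mem_enum mem_nth // -cardE ltn_pmod.
exists (i * #|A| + index x (enum A)).
  by rewrite (leq_trans _ (leq_addr _ _)) // leq_pmulr.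
by rewrite modnMDl modn_small ?nth_index ?mem_enum // cardE index_mem mem_enum.
Qed.

(** * A word without accepting path, all of whose small colourings can be pumped *)

Section HardLanguage.

Variable k : nat.
Local Notation place := 'I_k.+1.
Local Notation node := (option 'I_k.+1).
Implicit Types (alpha : nat -> letter) (rho : nat -> node).

Lemma conn_path alpha s t v (p q : node) :
  s <= t -> conn (factor alpha s t) v p q ->
  exists rho, [/\ rho s = p, rho t = q,
    forall i, s <= i < t -> step (alpha i) (rho i) (rho i.+1)
    & v -> exists2 i, s <= i < t & rho i = None].
Proof.
move=> /subnKC <-; move: (t - s) => d {t}; elim: d s v p => [|d IH] s v p.
  rewrite addn0 /factor subnn /= => /andP[/negbTE-> /eqP->].
  by exists (fun=> q); split=> // i; lia.
rewrite -addSnnS factorS ?leq_addr //= => /existsP[p' /andP[pp' /IH]].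
case=> rho [rho_s rho_t rho_step rho_v].
exists (fun i => if i == s then p else rho i); split.
- by rewrite eqxx.
- by rewrite ifN //; lia.
- move=> i /andP[]; rewrite leq_eqVlt => /predU1P[<- _|lt_si lt_it].
    by rewrite eqxx ifN ?rho_s //; lia.
  by rewrite !ifN; [apply: rho_step; lia|lia..].
move=> v_; case: (eqVneq p None) => [->|np].
  by exists s; rewrite ?eqxx //; lia.
have [|i lt_i rho_i] := rho_v; first by rewrite v_ np.
by exists i; [lia|rewrite ifN //; lia].
Qed.

Lemma path_conn alpha rho s t (v : bool) :
  (forall i, step (alpha i) (rho i) (rho i.+1)) -> s <= t ->
  (v -> exists2 i, s <= i < t & rho i = None) ->
  conn (factor alpha s t) v (rho s) (rho t).
Proof.
move=> rho_step /subnKC <-; move: (t - s) => d {t}; elim: d s v => [|d IH] s v vP.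
  rewrite addn0 /factor subnn /= eqxx andbT; apply/negP => /vP[i]; lia.
rewrite -addSnnS factorS ?leq_addr //=; apply/existsP; exists (rho s.+1).
rewrite rho_step; apply: IH => /andP[/vP[i /andP[le_si lt_i] rho_i] ns].
exists i; rewrite ?addSnnS ?lt_i ?andbT // ltn_neqAle le_si andbT.
by apply: contraNneq ns => ->; rewrite rho_i.
Qed.

(** This expresses acceptance by the hard automaton independently of the acceptance type. *)
Definition accepting_path alpha rho :=
  [/\ rho 0 != None, forall i, step (alpha i) (rho i) (rho i.+1)
    & forall i, exists2 j, i <= j & rho j = None].

(** Soundness keeps the path at a place at every cut point [t j], and each visit to [None] makes the
    rank drop at a later cut point: an infinite descent. *)
Lemma linked_not_accepted alpha (t : nat -> nat) (r : nat -> place -> nat) rho :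
  t 0 = 0 -> (forall j, t j < t j.+1) ->
  (forall i j, i < j -> sound (factor alpha (t i) (t j)) (r i) (r j)) ->
  ~ accepting_path alpha rho.
Proof.
move=> t0 t_incr snd [rho0 rho_step rho_None].
have t_ge j : j <= t j by elim: j => // j IH; apply: leq_ltn_trans (t_incr j).
have t_lt := homo_ltn ltn_trans t_incr.
have place_at j : exists x, rho (t j) = Some x.
  case: j => [|j]; first by rewrite t0; case: (rho 0) rho0 => // x; exists x.
  case E : (rho 0) rho0 => [x|//] _.
  have : conn (factor alpha (t 0) (t j.+1)) false (rho 0) (rho (t j.+1)).
    by rewrite t0; apply: path_conn.
  by rewrite E => /(snd 0 j.+1 isT)[y -> _]; exists y.
have [X XP] : exists X : nat -> place, forall j, rho (t j) = Some (X j).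
  by have [X] := choice place_at; exists X.
have drop i : exists2 j, i < j & r j (X j) < r i (X i).
  have [n le_n rho_n] := rho_None (t i); exists (maxn n i).+1; first by lia.
  have lt_i : i < (maxn n i).+1 by lia.
  have := @path_conn alpha rho _ _ true rho_step (ltnW (t_lt _ _ lt_i)).
  rewrite !XP => /(_ _)/(snd _ _ lt_i)[_|y [<-]]; last by rewrite addn1.
  exists n => //; rewrite le_n; have := t_ge (maxn n i).+1; lia.
have desc b i : r i (X i) < b -> False.
  elim: b i => // b IH i; rewrite ltnS => le_b.
  by have [j _ lt_j] := drop i; apply: (IH j); apply: leq_trans le_b.
exact: (desc (r 0 (X 0)).+1 0).
Qed.

(* The pumped word repeats a factor that leads from [f] to [g] when some place
   has a larger rank under [f] than under [g], so a path can cycle through that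
   place and the accepting node. *)
Lemma pumped_accepted m alpha s t (e f g : place -> nat) :
  s < t -> 0 < s -> 0 < m -> odd_onto m e ->
  (forall x, f x < 2 * m) -> (exists x, g x < f x) ->
  link m (factor alpha 0 s) e f -> link m (factor alpha s t) f g ->
  exists rho, accepting_path (alpha \o wrap s t) rho.
Proof.
move=> lt_st s_gt0 m_gt0 e_onto f_lt [x lt_gf] [_ c1] [_ c2].
(* [2 * m.-1 + 1] is the largest possible rank, so a place that has it under [e] is linked to every
   place under [f]. *)
have [x0 ex0] : exists x0, e x0 = 2 * m.-1 + 1 by apply: e_onto; rewrite prednK.
have {}c1 : conn (factor alpha 0 s) false (Some x0) (Some x).
  apply: conn_weak (c1 x0 x m.-1 _ _); rewrite ?prednK // ex0.
  by have := f_lt x; lia.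
have {}c2 : conn (factor alpha s t) true (Some x) (Some x).
  (* [2 * (g x)./2 + 1] is the least odd number that is at least [g x], hence at most [f x]. *)
  by have := c2 x x (g x)./2; rewrite lt_gf; apply; have := f_lt x; lia.
have := conn_path (leq0n s) c1 => -[rho1 [rho1_0 rho1_s rho1_step _]].
have := conn_path (ltnW lt_st) c2 => -[rho2 [rho2_s rho2_t rho2_step]].
move=> /(_ isT)[n /andP[le_sn lt_nt] rho2_n].
pose rho i := if i < s then rho1 i else rho2 i.
exists (rho \o wrap s t); split=> /=.
- by rewrite wrap_id ?(ltn_trans s_gt0) // /rho s_gt0 rho1_0.
- apply: (@wrap_path _ (fun i p q => step (alpha i) p q)) => //.
    by rewrite /rho ltnn ltnNge (ltnW lt_st) /= rho2_s rho2_t.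
  move=> i lt_it; rewrite /rho.
  case: (ltngtP i.+1 s) => [lt|gt|e_i].
  + by apply: rho1_step; lia.
  + by apply: rho2_step; lia.
  + by rewrite e_i rho2_s -rho1_s -e_i; apply: rho1_step; lia.
- move=> i; exists (n + i * (t - s)).
    by have := leq_mul2l i 1 (t - s); lia.
  by rewrite wrap_addM ?le_sn // /rho ltnNge le_sn.
Qed.

Definition rank m (f : {ffun place -> 'I_(2 * m)}) : place -> nat :=
  fun x => f x.

Lemma Q_ranking_onto m (f : {ffun place -> 'I_(2 * m)}) :
  @Q_ranking k.+2 m f -> odd_onto m (rank f).
Proof.
move/forallP=> fP i lt_im.
by have /existsP[x /eqP] := fP (Ordinal lt_im); exists x.
Qed.

(** [u] is any map into a small finite set, not necessarily a run, and [b] delays the loop; both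
    freedoms serve the deterministic case. *)
Lemma hard_word m : 0 < m -> 0 < num_Q_rankings k.+2 m ->
  exists alpha, ~ (exists rho, accepting_path alpha rho) /\
    forall (X : finType) (u : nat -> X) b, #|X| < num_Q_rankings k.+2 m ->
    exists s t, [/\ b <= s, s < t, u s = u t, Inf (u \o wrap s t) = Inf u
      & exists rho, accepting_path (alpha \o wrap s t) rho].
Proof.
move=> m_gt0 /cyclic_enumeration[h [hQ h_inf]].
have h_onto j : odd_onto m (rank (h j)) by apply/Q_ranking_onto/hQ.
have [V VP] : exists V : nat -> seq letter, forall j,
    0 < size (V j) /\ link m (V j) (rank (h j)) (rank (h j.+1)).
  have /choice[V VP] : forall j, exists w,
      0 < size w /\ link m w (rank (h j)) (rank (h j.+1)).
    by move=> j; apply: link_word.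
  by exists V.
have [alpha [t [t0 tP]]] := concat_words (fun j => proj1 (VP j)).
have t_incr j : t j < t j.+1 by have [] := tP j.
have t_ge j : j <= t j by elim: j => // j IH; apply: leq_ltn_trans (t_incr j).
have t_lt := homo_ltn ltn_trans t_incr.
have linked i j : i < j ->
    link m (factor alpha (t i) (t j)) (rank (h i)) (rank (h j)).
  elim: j => // j IH; rewrite ltnS leq_eqVlt => /predU1P[->|lt_ij].
    by have [_ ->] := tP j; have [] := VP j.
  rewrite (@factor_cat _ _ _ (t j)); last by apply/andP; split; apply/ltnW/t_lt.
  by apply: (link_cat (h_onto j) (IH lt_ij)); have [_ ->] := tP j; have [] := VP j.
exists alpha; split.
  case=> rho; apply: (linked_not_accepted t0 t_incr (r := fun j => rank (h j))).
  by move=> i j /linked[].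
move=> X u b ltX; apply: contrapT => no.
(* Each ranking receives a value of [u] that recurs at cut points carrying this ranking. Pumping
   being excluded, the assignment is injective, against the size of [X]. *)
have visited f : exists q, f \in @Q_ranking k.+2 m ->
    forall i, exists2 j, i <= j & h j = f /\ u (t j) = q.
  have [Qf|nQf] := boolP (f \in @Q_ranking k.+2 m); last by exists (u 0).
  by have [q qP] := infinite_pigeonhole (u \o t) (h_inf f Qf); exists q.
have [phi phiP] := choice visited.
have pump f g : f \in @Q_ranking k.+2 m -> g \in @Q_ranking k.+2 m ->
    phi f = phi g -> ~ (exists x, rank g x < rank f x).
  move=> Qf Qg eq_phi lt_gf; apply: no.
  have [b1 b1P] := eventually_Inf u.
  (* The loop begins after the transient values of [u] and, by the successor, at a positive
     position; [j] is then taken late enough for the loop to cover [Inf u]. *)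
  have [i le_i [hi ui]] := phiP f Qf (maxn b b1).+1.
  have [b2 b2P] := Inf_cover u (t i).
  have [j le_j [hj uj]] := phiP g Qg (maxn b2 i.+1).
  have lt_ij : i < j by lia.
  have le_it := t_ge i; have le_jt := t_ge j.
  exists (t i), (t j); split; [lia|exact: t_lt|by rewrite ui uj| |].
    by apply: Inf_wrap; [exact: t_lt|move=> ? ?; apply: b1P; lia|apply: b2P; lia].
  have li : link m (factor alpha 0 (t i)) (rank (h 0)) (rank f).
    by have := linked 0 i; rewrite t0 hi; apply; lia.
  apply: (pumped_accepted (t_lt _ _ lt_ij) _ m_gt0 (h_onto 0) _ lt_gf li).
  - lia.
  - by move=> x; apply: ltn_ord.
  - by rewrite -hi -hj; apply: linked.
have phi_inj : {in @Q_ranking k.+2 m &, injective phi}.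
  move=> f g Qf Qg eq_phi; apply/ffunP => x; apply/val_inj.
  case: (ltngtP (f x) (g x)) => // lt.
    by case: (pump g f Qg Qf (esym eq_phi)); exists x.
  by case: (pump f g Qf Qg eq_phi); exists x.
by move: ltX; rewrite ltnNge /num_Q_rankings -(card_in_image phi_inj) max_card.
Qed.

End HardLanguage.

(** * The hard automata, for all acceptance types *)

(** Every case says that [s] recurs. The Streett premise with [setT] always holds because infinity
    sets are nonempty; the parity colour is 0 at [s] and 1 elsewhere. *)
Definition hard_acc (T : acc_type) (S : finType) (s : S) : acc_cond T S :=
  match T return acc_cond T S with
  | Buchi => [set s]
  | GenBuchi => [:: [set s]]
  | Rabin => [:: ([set s], set0)]
  | Streett => [:: ([set s], setT)]
  | Muller => [set X : {set S} | s \in X]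
  | Parity => existT _ 1 (fun q => inord (q != s))
  end.

Lemma Inf_neq0 (S : finType) (rho : nat -> S) : exists q, q \in Inf rho.
Proof. by have [b bP] := eventually_Inf rho; exists (rho b); apply: bP. Qed.

Lemma setI1_neq0 (S : finType) (X : {set S}) s :
  (X :&: [set s] != set0) = (s \in X).
Proof.
apply/set0Pn/idP => [[x /setIP[Xx /set1P<-]]|Xs] //.
by exists s; rewrite inE Xs set11.
Qed.

Lemma successful_hard_acc (T : acc_type) (S : finType) (s : S) rho :
  successful (hard_acc T s) rho <-> s \in Inf rho.
Proof.
case: T => /=.
- by rewrite setI1_neq0.
- split=> [/(_ [set s])|sI F]; rewrite mem_seq1.
    by rewrite setI1_neq0; apply.
  by move=> /eqP->; rewrite setI1_neq0.
- split=> [[p]|sI]; last first.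
    by exists ([set s], set0); rewrite ?mem_seq1 //= setI1_neq0 setI0.
  by rewrite mem_seq1 => /eqP-> [+ _]; rewrite /= setI1_neq0.
- split=> [/(_ ([set s], setT))|sI p]; rewrite mem_seq1; last first.
    by move=> /eqP->; rewrite /= setI1_neq0.
  rewrite /= setI1_neq0 setIT; apply=> //.
  by have [q qI] := Inf_neq0 rho; apply/set0Pn; exists q.
- by rewrite inE.
- split=> [|sI].
    apply: contraR => sI; rewrite (eq_bigr (fun=> 1)); last first.
      move=> q qI; have -> : q != s by apply: contraNneq sI => <-.
      by rewrite inordK.
    by elim/big_ind: _ => // [x y] /=; rewrite /minn; case: ifP.
  suff -> : \big[minn/1]_(q in Inf rho) @inord 1 (q != s) = 0 by [].
  rewrite -big_filter.
  have : s \in [seq q <- index_enum S | q \in Inf rho].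
    by rewrite mem_filter sI mem_index_enum.
  elim: (filter _ _) => // q l IH; rewrite in_cons big_cons.
  by case/predU1P=> [<-|/IH->]; rewrite ?minn0 // eqxx inordK ?min0n.
Qed.

Lemma successful_Inf (T : acc_type) (S : finType) (c : acc_cond T S) rho rho' :
  Inf rho = Inf rho' -> successful c rho -> successful c rho'.
Proof. by case: T c => c /= ->. Qed.

Definition hard_automaton (k : nat) (T : acc_type) : automaton T letter :=
  @Automaton T letter (option 'I_k.+1) [set q | q != None]
    [set e | step e.1.2 e.1.1 e.2] (hard_acc T None).

Lemma lang_hard_automaton k (T : acc_type) alpha :
  lang (hard_automaton k T) alpha <->
  exists rho : nat -> option 'I_k.+1, accepting_path alpha rho.
Proof.
split=> [[rho [rho0 rho_step] /successful_hard_acc/InfP rho_None]|].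
  exists rho; split=> //; first by rewrite inE in rho0.
  by move=> i; have := rho_step i; rewrite inE.
case=> rho [rho0 rho_step rho_None]; exists rho.
  by split=> [|i]; rewrite inE /=.
exact/successful_hard_acc/InfP.
Qed.

Lemma run_wrap (T : acc_type) (Sigma : finType) (B : automaton T Sigma)
    (alpha : nat -> Sigma)
    (rho : nat -> state B) s t :
  0 < s -> s < t -> rho s = rho t -> run alpha rho ->
  run (alpha \o wrap s t) (rho \o wrap s t).
Proof.
move=> s_gt0 lt_st eq_rho [rho0 rho_step]; split.
  by rewrite /= wrap_id // (ltn_trans s_gt0).
exact: (@wrap_path _ (fun i p q => (p, alpha i, q) \in trans B)).
Qed.

(** * Runs of deterministic automata *)

Section Deterministic.

Variables (T : acc_type) (Sigma : finType) (B : automaton T Sigma).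
Hypothesis detB : deterministic B.

Lemma deterministic_run_eq (alpha beta : nat -> Sigma)
    (rho rho' : nat -> state B) n :
  run alpha rho -> run beta rho' -> (forall i, i < n -> alpha i = beta i) ->
  rho n = rho' n.
Proof.
have [/eqP/cards1P[q0 initE] dt] := detB.
move=> [rho0 rs] [rho'0 rs']; elim: n => [_|n IH eq_ab].
  by move: rho0 rho'0; rewrite initE => /set1P-> /set1P->.
apply: (dt (rho n) (alpha n)); first exact: rs.
by rewrite IH ?eq_ab // => i lt_in; apply: eq_ab; apply: ltnW.
Qed.

(** Transitions may be missing, so a run on [alpha] is not automatic. Runs on words with a common
    prefix agree along it, and the diagonal [R n n] glues them. *)
Lemma deterministic_run (alpha : nat -> Sigma) :
  (forall n, exists2 beta, forall i, i < n -> alpha i = beta i &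
    exists rho : nat -> state B, run beta rho) ->
  exists rho : nat -> state B, run alpha rho.
Proof.
move=> prefix.
have [R RP] : exists R : nat -> nat -> state B, forall n, exists2 beta,
    forall i, i < n -> alpha i = beta i & run beta (R n).
  have /choice[R RP] : forall n, exists rho : nat -> state B, exists2 beta,
      forall i, i < n -> alpha i = beta i & run beta rho.
    by move=> n; have [beta eq_ab [rho rr]] := prefix n; exists rho, beta.
  by exists R.
exists (fun n => R n n); split=> [|i]; first by have [beta _ []] := RP 0.
have [beta eq_b rb] := RP i; have [beta' eq_b' rb'] := RP i.+1.
rewrite (@deterministic_run_eq _ _ _ _ i rb rb').
  by rewrite eq_b' //; have [_] := rb'; apply.
by move=> j lt_ji; rewrite -eq_b // eq_b' // ltnW.
Qed.

End Deterministic.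

Theorem theorem4p10 :
  exists C : nat, forall n : nat, 1 < n -> forall T1 : acc_type,
  exists (Sigma : finType) (A : automaton T1 Sigma),
    [/\ #|Sigma| <= C,
        #|state A| = n,
        forall (T2 : acc_type) (B : automaton T2 Sigma),
          lang B = (~` lang A)%classic -> L n <= #|state B|
      & forall T2 : acc_type, T2 <> Buchi -> T2 <> GenBuchi ->
        forall B : automaton T2 Sigma,
          deterministic B -> lang B = lang A -> L n <= #|state B|].
Proof.
(* For [n = k.+2] there are [k.+1] places, and [None] is the remaining state. *)
exists 6 => -[|[|k]] // _ T1; exists letter, (hard_automaton k T1).
have L_bound N : (forall m, 0 < m -> 0 < num_Q_rankings k.+2 m ->
    num_Q_rankings k.+2 m <= N) -> L k.+2 <= N.
  move=> bnd; apply/bigmax_leqP_seq => m; rewrite mem_index_iota => /andP[m_gt0 _] _.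
  by have [->|?] := posnP (num_Q_rankings k.+2 m); last exact: bnd.
split; first exact: card_letter.
- by rewrite /= card_option card_ord.
- move=> T2 B langB; apply: L_bound => m m_gt0 Q_gt0.
  have [alpha [alphaN pump]] := hard_word m_gt0 Q_gt0.
  rewrite leqNgt; apply/negP => ltB.
  have : lang B alpha by rewrite langB => /lang_hard_automaton.
  case=> rho rho_run rho_acc.
  have [s [t [s_gt0 lt_st eq_rho eq_Inf acc_w]]] := pump _ rho 1 ltB.
  have : lang B (alpha \o wrap s t).
    exists (rho \o wrap s t); first exact: run_wrap.
    exact: successful_Inf (esym eq_Inf) rho_acc.
  by rewrite langB; apply; apply/lang_hard_automaton.
- move=> T2 _ _ B detB langB; apply: L_bound => m m_gt0 Q_gt0.
  have [alpha [alphaN pump]] := hard_word m_gt0 Q_gt0.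
  have B_gt0 : 0 < #|state B| by have [<- _] := detB; apply: max_card.
  rewrite leqNgt; apply/negP => ltB.
  have [|rho rho_run] := @deterministic_run _ _ _ detB alpha.
    (* The constant map to [unit] is used only to get accepted words that agree with [alpha] up to
       [n]; the size condition holds because [B] has a state and fewer states than there are
       rankings. *)
    move=> n; have [|s [t [le_ns lt_st _ _]]] := pump unit (fun=> tt) n.
      by rewrite card_unit; apply: leq_ltn_trans ltB.
    move=> /(lang_hard_automaton k T1); rewrite -langB => -[rho rho_run _].
    exists (alpha \o wrap s t); last by exists rho.
    by move=> i lt_in /=; rewrite wrap_id //; lia.
  have [s [t [s_gt0 lt_st eq_rho eq_Inf]]] := pump _ rho 1 ltB.
  move=> /(lang_hard_automaton k T1); rewrite -langB => -[rho' rho'_run rho'_acc].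
  (* By determinism the accepting run on the pumped word is the wrapped [rho], whose infinity set is
     that of [rho]; so [B] would accept [alpha] itself. *)
  apply: alphaN; apply/(lang_hard_automaton k T1); rewrite -langB.
  exists rho => //; apply: successful_Inf rho'_acc.
  suff -> : rho' = rho \o wrap s t by [].
  apply/funext => i; apply: (deterministic_run_eq detB rho'_run) => //.
  exact: run_wrap.
Qed.
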